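(* Let $P$ be an unknown distribution and $Q$ a known distribution, both over $\{0,1\}^n$. Given subcube conditioning access to $P$, an approximation parameter $\zeta\in(0,1)$ and a confidence parameter $\delta\in(0,1)$, there exists an algorithm that takes $\widetilde{\mathcal{O}}(n^2)$ subcube-conditional samples from $P$ in expectation and outputs an estimate of $\mathsf{d_{TV}}(P,Q)$ with additive error at most $\zeta$ with probability at least $1-\delta$.
   Context: Subcube conditioning access to $P$: for any sets $A_1,\dots,A_n\subseteq\{0,1\}$, with $S=A_1\times\dots\times A_n$, one can obtain a sample $x\in S$ drawn with probability $P(x)/\sum_{w\in S}P(w)$ (if $P(S)=0$, an element of $S$ uniformly at random). $Q$ known means $Q(x)$ is available for every $x$. $\mathsf{d_{TV}}(P,Q)=\max_{A\subseteq\{0,1\}^n}(P(A)-Q(A))$. $\widetilde{\mathcal{O}}$ hides polylogarithmic factors (the dependence on $\zeta,\delta$ is suppressed in the stated bound). *)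

(* Defs.v *)
From mathcomp Require Import all_boot all_order all_algebra.
From mathcomp Require Import all_classical all_reals all_analysis.

Set Implicit Arguments.
Unset Strict Implicit.
Unset Printing Implicit Defensive.

Import Order.TTheory GRing.Theory Num.Theory.

Local Open Scope classical_set_scope.
Local Open Scope ring_scope.

Definition cube (n : nat) := {ffun 'I_n -> bool}.

Record dist (R : realType) (n : nat) := Dist {
  pmf :> cube n -> R;
  pmf_ge0 : forall x, 0 <= pmf x;
  pmf_sum1 : \sum_x pmf x = 1 }.

Definition mass (R : realType) (n : nat) (P : dist R n) (A : {set cube n}) : R :=
  \sum_(x in A) P x.

(* The default value 0 of the maximum is already attained at A = set0. *)
Definition dTV (R : realType) (n : nat) (P Q : dist R n) : R :=
  \big[Num.max/0]_(A : {set cube n}) (mass P A - mass Q A).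

(* The sides are required to be nonempty: nothing can be sampled from an empty
   product. *)
Record subcube (n : nat) := Subcube {
  side :> 'I_n -> {set bool};
  side_neq0 : forall i, side i != finset.set0 }.

Definition points (n : nat) (S : subcube n) : {set cube n} :=
  [set x : cube n | [forall i, x i \in S i]]%SET.

Definition cond (R : realType) (n : nat) (P : dist R n) (S : subcube n)
    (x : cube n) : R :=
  if x \in points S then
    if mass P (points S) == 0 then #|points S|%:R^-1 else P x / mass P (points S)
  else 0.

(* A randomized adaptive algorithm making subcube-conditional queries is a
   decision tree whose nodes are queries, branching on the sample received, or
   tosses of a private fair coin, and whose leaves carry the output. The tree
   may have infinite branches, since only the expected number of queries is
   to be bounded. The distribution being sampled is not an argument of the
   tree: it only enters through [run] below. *)
CoInductive algo (R : realType) (n : nat) : Type :=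
| Output of R
| Sample of subcube n & (cube n -> algo R n)
| Toss of (bool -> algo R n).

(* [run P t f c a] is the expectation of [f a' c'], where a' is what remains of
   [a] after (at most) t steps against [P], and c' is [c] plus the number of
   samples drawn during these steps. *)
Fixpoint run (R : realType) (n : nat) (P : dist R n) (t : nat)
    (f : algo R n -> nat -> R) (c : nat) (a : algo R n) : R :=
  if t is t'.+1 then
    match a with
    | Output _ => f a c
    | Sample B k => \sum_(x : cube n) cond P B x * run P t' f c.+1 (k x)
    | Toss k => (run P t' f c (k true) + run P t' f c (k false)) / 2
    end
  else f a c.

Definition outputs_in (R : realType) (n : nat) (E : pred R) (a : algo R n) : bool :=
  if a is Output r then E r else false.

(* Both families below are nondecreasing in t, so the suprema are the limits:
   the probability of ever halting with an output in [E], and, by monotone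
   convergence, the expectation of the total number of samples. *)
Definition prob_output (R : realType) (n : nat) (P : dist R n) (a : algo R n)
    (E : pred R) : \bar R :=
  ereal_sup (range (fun t : nat =>
    (run P t (fun b _ => (outputs_in E b)%:R) 0 a)%:E)).

Definition expected_samples (R : realType) (n : nat) (P : dist R n)
    (a : algo R n) : \bar R :=
  ereal_sup (range (fun t : nat => (run P t (fun _ c => c%:R) 0 a)%:E)).

(* Main.v *)
(** Write dTV(P, Q) as the mean over x drawn from P of max(0, 1 - Q(x)/P(x)).
    By the chain rule, P(x) is the product over i of
    p_i = P(x_i | x_0, ..., x_(i-1)), and p_i is the probability that a sample
    from the subcube fixing the first i coordinates to those of x agrees with x
    at i. If N_i is the number of such samples needed to see r agreements, then
    N_i / r is an unbiased estimate of 1/p_i with relative variance at most 1/r,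
    so for r of order n / zeta^2 the product of the N_i / r is within a factor
    1 +- O(zeta) of 1/P(x) in mean square. Since Q(x)/P(x) has P-mean at most 1,
    the resulting estimate of the distance has bias O(zeta); averaging a constant
    number of copies and applying Chebyshev's inequality concludes.

    Waiting for r agreements costs r/p_i samples on average, and the P-mean of
    1/p_i is at most 2, whence O(n r) = O(n^2) samples. Each wait is cut off after
    L samples, which by Markov's inequality fails with small probability and
    makes all the query trees finite. *)

Require Import Defs.
From mathcomp Require Import all_boot all_order all_algebra.
From mathcomp Require Import all_classical all_reals all_analysis.
From mathcomp Require Import ring lra.

Set Implicit Arguments.
Unset Strict Implicit.
Unset Printing Implicit Defensive.

Import Order.TTheory GRing.Theory Num.Theory.

Local Open Scope ring_scope.

(** * Conditional distributions *)

Lemma mass_ge0 (R : realType) (n : nat) (P : dist R n) (A : {set cube n}) :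
  0 <= mass P A.
Proof. by apply: sumr_ge0 => x _; exact: Defs.pmf_ge0. Qed.

Lemma points_neq0 (n : nat) (S : subcube n) : (0 < #|points S|)%N.
Proof.
apply/card_gt0P.
exists [ffun i => odflt true [pick b in S i]].
rewrite inE; apply/forallP => i; rewrite ffunE.
case: pickP => [b //|S0].
by have /set0Pn[b] := side_neq0 S i; rewrite S0.
Qed.

Lemma cond_ge0 (R : realType) (n : nat) (P : dist R n) (S : subcube n) x :
  0 <= cond P S x.
Proof.
rewrite /cond; case: ifP => // _; case: ifP => _; first by rewrite invr_ge0.
by rewrite divr_ge0 ?mass_ge0 ?Defs.pmf_ge0.
Qed.

Lemma cond_sum1 (R : realType) (n : nat) (P : dist R n) (S : subcube n) :
  \sum_x cond P S x = 1.
Proof.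
rewrite /cond -big_mkcond /=; case: eqVneq => [_|M0].
  by rewrite sumr_const -(mulr_natr _^-1) mulVf // pnatr_eq0 -lt0n points_neq0.
by rewrite -mulr_suml mulfV.
Qed.

(** * Query trees of finite depth *)

(** An inductive counterpart of [algo]: finiteness gives exact means and costs by structural
    recursion, and the free leaf type lets subroutines compose through [bind]. There are no coin
    tosses, since all the randomness comes from the samples. *)
Inductive tree (n : nat) (T : Type) : Type :=
| Ret of T
| Ask of subcube n & (cube n -> tree n T).

Arguments Ret {n T} _.
Arguments Ask {n T} _ _.

Fixpoint bind (n : nat) (T U : Type) (t : tree n T) (g : T -> tree n U) :
    tree n U :=
  match t with
  | Ret v => g v
  | Ask B k => Ask B (fun x => bind (k x) g)
  end.

Fixpoint algo_of (R : realType) (n : nat) (t : tree n R) : algo R n :=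
  match t with
  | Ret v => Output n v
  | Ask B k => Sample B (fun x => algo_of (k x))
  end.

Fixpoint depth (n : nat) (T : Type) (t : tree n T) : nat :=
  match t with
  | Ret _ => 0
  | Ask B k => (\max_x depth (k x)).+1
  end.

Fixpoint ex (R : realType) (n : nat) (P : dist R n) (T : Type) (f : T -> R)
    (t : tree n T) : R :=
  match t with
  | Ret v => f v
  | Ask B k => \sum_x cond P B x * ex P f (k x)
  end.

Fixpoint cost (R : realType) (n : nat) (P : dist R n) (T : Type)
    (t : tree n T) : R :=
  match t with
  | Ret _ => 0
  | Ask B k => \sum_x cond P B x * (1 + cost P (k x))
  end.

Section Trees.
Context (R : realType) (n : nat) (P : dist R n).

Lemma cond_mean_const (B : subcube n) (u : R) : \sum_x cond P B x * u = u.
Proof. by rewrite -mulr_suml cond_sum1 mul1r. Qed.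

Lemma ler_cond_mean (B : subcube n) (u v : cube n -> R) :
  (forall x, u x <= v x) ->
  \sum_x cond P B x * u x <= \sum_x cond P B x * v x.
Proof. by move=> uv; apply: ler_sum => x _; rewrite ler_wpM2l ?cond_ge0. Qed.

Lemma eq_ex (T : Type) (f g : T -> R) (t : tree n T) :
  f =1 g -> ex P f t = ex P g t.
Proof. by move=> fg; elim: t => //= B k IH; apply: eq_bigr => x _; rewrite IH. Qed.

Lemma ler_ex (T : Type) (f g : T -> R) (t : tree n T) :
  (forall v, f v <= g v) -> ex P f t <= ex P g t.
Proof. by move=> fg; elim: t => //= B k IH; apply: ler_cond_mean. Qed.

Lemma ler_norm_ex (T : Type) (f g : T -> R) (t : tree n T) :
  (forall v, `|f v| <= g v) -> `|ex P f t| <= ex P g t.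
Proof.
move=> fg; elim: t => //= B k IH; apply: le_trans (ler_norm_sum _ _ _) _.
by apply: ler_sum => x _; rewrite normrM ger0_norm ?cond_ge0 // ler_wpM2l ?cond_ge0.
Qed.

Lemma exD (T : Type) (f g : T -> R) (t : tree n T) :
  ex P (fun v => f v + g v) t = ex P f t + ex P g t.
Proof.
elim: t => //= B k IH; rewrite -big_split /=.
by apply: eq_bigr => x _; rewrite IH mulrDr.
Qed.

Lemma exZ (T : Type) (c : R) (f : T -> R) (t : tree n T) :
  ex P (fun v => c * f v) t = c * ex P f t.
Proof.
by elim: t => //= B k IH; rewrite mulr_sumr; apply: eq_bigr => x _; rewrite IH mulrCA.
Qed.

Lemma ex_const (T : Type) (c : R) (t : tree n T) : ex P (fun=> c) t = c.
Proof.
elim: t => //= B k IH; rewrite -[RHS](cond_mean_const B).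
by apply: eq_bigr => x _; rewrite IH.
Qed.

Lemma ex_bind (T U : Type) (f : U -> R) (t : tree n T) (g : T -> tree n U) :
  ex P f (bind t g) = ex P (fun v => ex P f (g v)) t.
Proof. by elim: t => //= B k IH; apply: eq_bigr => x _; rewrite IH. Qed.

Lemma cost_bind (T U : Type) (t : tree n T) (g : T -> tree n U) :
  cost P (bind t g) = cost P t + ex P (fun v => cost P (g v)) t.
Proof.
elim: t => [v|B k IH] /=; first by rewrite add0r.
by rewrite -big_split /=; apply: eq_bigr => x _; rewrite IH addrA mulrDr.
Qed.

Lemma run_algo_of (f : algo R n -> nat -> R) (g : R -> R) (s c : nat)
    (t : tree n R) : (forall v c', f (Output n v) c' = g v) ->
  (depth t <= s)%N -> run P s f c (algo_of t) = ex P g t.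
Proof.
move=> fg; elim: t s c => [v|B k IH] [|s] c //= ds.
apply: eq_bigr => x _; rewrite IH //.
exact: leq_trans (leq_bigmax x) ds.
Qed.

(** Only an inequality, because the [s] steps may end before a leaf is reached. *)
Lemma run_count_le (s c : nat) (t : tree n R) :
  run P s (fun _ c' => c'%:R) c (algo_of t) <= c%:R + cost P t.
Proof.
have cost_ge0 (u : tree n R) : 0 <= cost P u.
  elim: u => //= B k IH; apply: sumr_ge0 => x _.
  by rewrite mulr_ge0 ?cond_ge0 // addr_ge0.
elim: s c t => [|s IH] c [v|B k] /=; rewrite ?addr0 //.
  by rewrite lerDl; exact: (cost_ge0 (Ask B k)).
rewrite -[X in _ <= X + _](cond_mean_const B) -big_split /=.
under [leRHS]eq_bigr do rewrite -mulrDr.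
by apply: ler_cond_mean => x; rewrite addrA natr1.
Qed.

Lemma run_le1 (s c : nat) (E : pred R) (t : tree n R) :
  run P s (fun b _ => (outputs_in E b)%:R) c (algo_of t) <= 1.
Proof.
elim: s c t => [|s IH] c [v|B k] //=; rewrite ?lern1 ?leq_b1 //.
rewrite -[leRHS](cond_mean_const B).
by apply: ler_cond_mean => x.
Qed.

Lemma expected_samples_le (t : tree n R) (M : R) :
  cost P t <= M -> (expected_samples P (algo_of t) <= M%:E)%E.
Proof.
move=> tM; apply: ge_ereal_sup => _ [s _ <-].
rewrite lee_fin; apply: le_trans tM.
by have := run_count_le s 0 t; rewrite add0r.
Qed.

Lemma prob_output_ge (t : tree n R) (E : pred R) :
  ((ex P (fun v => (E v)%:R) t)%:E <= prob_output P (algo_of t) E)%E.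
Proof.
apply: ereal_sup_ubound; exists (depth t) => //.
by rewrite (@run_algo_of _ (fun v => (E v)%:R)).
Qed.

Lemma prob_output_total (t : tree n R) : prob_output P (algo_of t) predT = 1%E.
Proof.
apply/eqP; rewrite eq_le; apply/andP; split.
  by apply: ge_ereal_sup => _ [s _ <-]; rewrite lee_fin run_le1.
by have := prob_output_ge t predT; rewrite ex_const.
Qed.

End Trees.

(** * Negative binomial sampling *)

(** Here [L] is the remaining budget, [r] the number of hits still missing and [c] the number of
    samples drawn. Testing [r] first makes a last hit on the final allowed sample count as
    success. *)
Fixpoint wait (n : nat) (B : subcube n) (hit : pred (cube n)) (L r c : nat) :
    tree n (option nat) :=
  if r is r'.+1 then
    if L is L'.+1 then
      Ask B (fun y => if hit y then wait B hit L' r' c.+1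
                      else wait B hit L' r c.+1)
    else Ret None
  else Ret (Some c).

Definition hit_prob (R : realType) (n : nat) (P : dist R n) (B : subcube n)
    (hit : pred (cube n)) : R :=
  \sum_y cond P B y * (hit y)%:R.

Section Wait.
Context (R : realType) (n : nat) (P : dist R n) (B : subcube n).
Context (hit : pred (cube n)).
Let p := hit_prob P B hit.

(** Reduces each step of [wait] to a Bernoulli trial of parameter [p]. *)
Lemma cond_mean_if (u v : R) :
  \sum_y cond P B y * (if hit y then u else v) = p * u + (1 - p) * v.
Proof.
rewrite -[X in (X - _) * _](cond_sum1 P B) /p /hit_prob -sumrB !mulr_suml.
rewrite -big_split /=; apply: eq_bigr => y _.
by case: (hit y); rewrite ?mulr1 ?mulr0 ?subr0 ?subrr ?mul0r ?addr0 ?add0r.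
Qed.

Lemma hit_prob_le1 : p <= 1.
Proof.
rewrite -(cond_sum1 P B); apply: ler_sum => y _.
by case: (hit y); rewrite ?mulr1 ?mulr0 ?cond_ge0.
Qed.

Hypothesis p_gt0 : 0 < p.

Lemma cost_wait (L r c : nat) : cost P (wait B hit L r c) <= r%:R / p.
Proof.
elim: L r c => [|L IH] [|r] c /=;
  rewrite ?divr_ge0 ?ler0n ?(ltW p_gt0) //.
apply: (@le_trans _ _
  (\sum_y cond P B y * (if hit y then 1 + r%:R / p else 1 + r.+1%:R / p))).
  by apply: ler_cond_mean => y; case: (hit y); rewrite lerD2l IH.
rewrite cond_mean_if -natr1 le_eqVlt; apply/orP; left; apply/eqP; field.
by rewrite gt_eqF.
Qed.

(* Markov's inequality for the number of samples drawn: a failing run has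
   drawn [c + L] of them. *)
Lemma wait_fail (L r c : nat) :
  ex P (fun o : option nat => (~~ o)%:R) (wait B hit L r c) * (c + L)%:R <= c%:R + r%:R / p.
Proof.
elim: L r c => [|L IH] [|r] c /=;
  rewrite ?mul0r ?mul1r ?addn0 ?addr_ge0 ?lerDl ?divr_ge0 ?ler0n ?(ltW p_gt0) //.
rewrite mulr_suml; apply: (@le_trans _ _
  (\sum_y cond P B y *
     (if hit y then c.+1%:R + r%:R / p else c.+1%:R + r.+1%:R / p))).
  apply: ler_sum => y _; rewrite -mulrA ler_wpM2l ?cond_ge0 //.
  by rewrite addnS -addSn; case: (hit y); rewrite IH.
rewrite cond_mean_if -2!natr1 le_eqVlt; apply/orP; left; apply/eqP; field.
by rewrite gt_eqF.
Qed.

(* The right-hand side is the mean of the quadratic at the sum of [r] geometric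
   variables; it is an upper bound because failing runs are dropped from a
   nonnegative quantity. *)
Lemma wait_quadratic (q : R -> R) (a b d : R) (L r c : nat) :
  0 <= a -> (forall v, q v = a * v ^+ 2 + b * v + d) -> (forall v, 0 <= q v) ->
  ex P (fun o => if o is Some c' then q c'%:R else 0) (wait B hit L r c)
  <= q (c%:R + r%:R / p) + a * r%:R * (1 - p) / p ^+ 2.
Proof.
move=> a0 qE q0.
have var_ge0 (s : nat) : 0 <= a * s%:R * (1 - p) / p ^+ 2.
  by rewrite divr_ge0 ?mulr_ge0 ?subr_ge0 ?hit_prob_le1 ?exprn_ge0 // ltW.
elim: L r c => [|L IH] [|r] c /=;
  rewrite ?mulr0 ?mul0r ?addr0 ?addr_ge0 //.
(* The mean [c + r/p] and the variance [r(1-p)/p^2] satisfy the first-step recursion with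
   equality. *)
apply: (@le_trans _ _
  (\sum_y cond P B y *
     (if hit y then q (c.+1%:R + r%:R / p) + a * r%:R * (1 - p) / p ^+ 2
      else q (c.+1%:R + r.+1%:R / p) + a * r.+1%:R * (1 - p) / p ^+ 2))).
  by apply: ler_cond_mean => y; case: (hit y); rewrite IH.
rewrite cond_mean_if !qE -2!natr1 le_eqVlt; apply/orP; left; apply/eqP; field.
by rewrite gt_eqF.
Qed.

End Wait.

(** * The chain rule along a point *)

Definition prefix_side (n : nat) (x : cube n) (i : nat) (j : 'I_n) : {set bool} :=
  if (j < i)%N then [set x j]%SET else [set: bool]%SET.

Lemma prefix_side_neq0 (n : nat) (x : cube n) (i : nat) (j : 'I_n) :
  prefix_side x i j != finset.set0.
Proof.
by apply/set0Pn; exists (x j); rewrite /prefix_side; case: ifP; rewrite !inE.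
Qed.

Definition prefix (n : nat) (x : cube n) (i : nat) : subcube n :=
  Subcube (prefix_side_neq0 x i).

Lemma mem_prefixP (n : nat) (x y : cube n) (i : nat) :
  reflect (forall j : 'I_n, (j < i)%N -> y j = x j) (y \in points (prefix x i)).
Proof.
rewrite inE; apply: (iffP forallP) => /= xy j.
  by move=> ji; have := xy j; rewrite /prefix_side ji inE => /eqP.
by rewrite /prefix_side; case: ifP => [/xy ->|]; rewrite !inE.
Qed.

Lemma mem_prefixS (n : nat) (x y : cube n) (i : 'I_n) :
  (y \in points (prefix x i.+1)) =
  (y \in points (prefix x i)) && (y i == x i).
Proof.
apply/mem_prefixP/andP => [xy|[/mem_prefixP xy /eqP xyi] j].
  split; last by rewrite xy.
  by apply/mem_prefixP => j ji; apply: xy; rewrite ltnS ltnW.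
rewrite ltnS leq_eqVlt => /orP[/eqP ji|/xy //].
by rewrite (_ : j = i) //; apply: val_inj.
Qed.

Lemma mem_prefix_refl (n : nat) (x : cube n) (i : nat) :
  x \in points (prefix x i).
Proof. exact/mem_prefixP. Qed.

Lemma mem_prefix_sym (n : nat) (x y : cube n) (i : nat) :
  (y \in points (prefix x i)) = (x \in points (prefix y i)).
Proof. by apply/mem_prefixP/mem_prefixP => xy j /xy. Qed.

Lemma points_prefix0 (n : nat) (x : cube n) :
  points (prefix x 0) = [set: cube n]%SET.
Proof. by apply/setP => y; rewrite finset.in_setT; apply/mem_prefixP. Qed.

Lemma points_prefix_full (n : nat) (x : cube n) :
  points (prefix x n) = [set x]%SET.
Proof.
apply/setP => y; rewrite finset.in_set1; apply/mem_prefixP/eqP => [xy|-> //].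
by apply/ffunP => j; apply: xy.
Qed.

Lemma points_prefix_eq (n : nat) (x y : cube n) (i : nat) :
  y \in points (prefix x i) -> points (prefix y i) = points (prefix x i).
Proof.
move=> /mem_prefixP xy; apply/setP => w.
by apply/mem_prefixP/mem_prefixP => h j ji; rewrite h // xy.
Qed.

(** The factor p_i of the chain rule. *)
Definition step_prob (R : realType) (n : nat) (P : dist R n) (x : cube n)
    (i : 'I_n) : R :=
  hit_prob P (prefix x i) (fun y => y i == x i).

Section Chain_rule.
Context (R : realType) (n : nat) (P : dist R n).

Lemma mass_prefix_gt0 (x : cube n) (i : nat) :
  0 < P x -> 0 < mass P (points (prefix x i)).
Proof.
move=> Px; rewrite /mass (bigD1 x) ?mem_prefix_refl //= ltr_wpDr //.
by apply: sumr_ge0 => y _; exact: Defs.pmf_ge0.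
Qed.

(** Positivity of [P x] rules out the uniform default in [cond]. The ratios then telescope from the
    mass 1 of the cube down to [P x]. *)
Lemma step_probE (x : cube n) (i : 'I_n) : 0 < P x ->
  step_prob P x i =
  mass P (points (prefix x i.+1)) / mass P (points (prefix x i)).
Proof.
move=> Px; have M0 := mass_prefix_gt0 i Px.
rewrite /step_prob /hit_prob /cond (gt_eqF M0) /mass mulr_suml [RHS]big_mkcond /=.
apply: eq_bigr => y _; rewrite mem_prefixS.
by case: (y \in _); case: (_ == _); rewrite ?mulr1 ?mulr0 ?mul0r.
Qed.

Lemma step_prob_gt0 (x : cube n) (i : 'I_n) : 0 < P x -> 0 < step_prob P x i.
Proof. by move=> Px; rewrite step_probE // divr_gt0 ?mass_prefix_gt0. Qed.

Lemma prod_step_prob (x : cube n) :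
  0 < P x -> \prod_(i <- enum 'I_n) step_prob P x i = P x.
Proof.
move=> Px; rewrite big_enum /=.
under eq_bigr do rewrite step_probE //.
have telescope k : \prod_(0 <= i < k)
    (mass P (points (prefix x i.+1)) / mass P (points (prefix x i))) =
    mass P (points (prefix x k)).
  elim: k => [|k IH].
    rewrite big_geq // points_prefix0 /mass -(pmf_sum1 P).
    by apply: eq_bigl => y; rewrite finset.in_setT.
  by rewrite big_nat_recr //= IH mulrC divfK // gt_eqF // mass_prefix_gt0.
rewrite -(big_mkord predT (fun i => mass P (points (prefix x i.+1)) /
  mass P (points (prefix x i)))) telescope points_prefix_full /mass.
by rewrite big_set1.
Qed.

(* Given the first [i] coordinates, coordinate [i] takes each of its two values
   [b] with the probability whose inverse is being averaged. *)
Lemma sum_inv_step_prob (i : 'I_n) : \sum_x P x / step_prob P x i <= 2.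
Proof.
(* Dividing by the ratio of masses puts the mass of the shorter prefix in the numerator; it is
   expanded as a sum over [y], and the two sums are exchanged. *)
have -> : \sum_x P x / step_prob P x i =
    \sum_y P y * (\sum_(x | x \in points (prefix y i))
                    P x / mass P (points (prefix x i.+1))).
  transitivity (\sum_x \sum_(y in points (prefix x i))
                  P y * (P x / mass P (points (prefix x i.+1)))).
    apply: eq_bigr => x _; rewrite -mulr_suml -/(mass P _).
    have := Defs.pmf_ge0 P x; rewrite le_eqVlt => /orP[/eqP <-|Px].
      by rewrite !mul0r mulr0.
    by rewrite step_probE // invf_div mulrCA.
  rewrite (exchange_big_dep predT) //=; apply: eq_bigr => y _.
  rewrite mulr_sumr; apply: eq_bigl => x; exact: mem_prefix_sym.
have -> : 2 = \sum_y P y * 2 :> R by rewrite -mulr_suml pmf_sum1 mul1r.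
apply: ler_sum => y _.
rewrite ler_wpM2l ?Defs.pmf_ge0 //.
(* Each value of bit [i] contributes 1, or 0 when its class has mass zero. *)
rewrite (partition_big (fun x : cube n => x i) predT) //=.
apply: (@le_trans _ _ (\sum_(b : bool) 1)); last by rewrite big_bool.
apply: ler_sum => b _.
pose S := [set x : cube n | (x \in points (prefix y i)) && (x i == b)]%SET.
have SE x : x \in S -> points (prefix x i.+1) = S.
  rewrite finset.in_set => /andP[xy /eqP xb]; apply/setP => w.
  by rewrite mem_prefixS (points_prefix_eq xy) xb [RHS]finset.in_set.
rewrite (eq_bigl (fun x => x \in S)); last by move=> x; rewrite [RHS]finset.in_set.
rewrite (eq_bigr (fun x => P x / mass P S)); last by move=> x /SE ->.
rewrite -mulr_suml -/(mass P S).
by have [->|S0] := eqVneq (mass P S) 0; rewrite ?mul0r ?divff.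
Qed.

End Chain_rule.

(** * Estimating the inverse probability of a point *)

(** The accumulator [z] carries the product of the ratios [c / r]; each coordinate has its own
    budget [L]. *)
Fixpoint chain (R : realType) (n : nat) (x : cube n) (L r : nat)
    (l : seq 'I_n) (z : R) : tree n (option R) :=
  if l is i :: l' then
    bind (wait (prefix x i) (fun y => y i == x i) L r 0) (fun o =>
      if o is Some c then chain x L r l' (z * (c%:R / r%:R)) else Ret None)
  else Ret (Some z).

Section Chain.
Context (R : realType) (n : nat) (P : dist R n) (x : cube n).
Hypothesis Px : 0 < P x.

Lemma sum_inv_step_ge0 (r : nat) (l : seq 'I_n) :
  0 <= \sum_(i <- l) r%:R / step_prob P x i.
Proof.
by apply: sumr_ge0 => i _; rewrite divr_ge0 ?ler0n // ltW ?step_prob_gt0.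
Qed.

Lemma cost_chain (L r : nat) (l : seq 'I_n) (z : R) :
  cost P (chain x L r l z) <= \sum_(i <- l) r%:R / step_prob P x i.
Proof.
elim: l z => [|i l IH] z /=; first by rewrite big_nil.
rewrite cost_bind big_cons lerD //.
  exact: cost_wait (step_prob_gt0 i Px) _ _ _.
rewrite -[leRHS](ex_const P _ (wait (prefix x i) (fun y => y i == x i) L r 0)).
by apply: ler_ex => -[c|] //=; apply: sum_inv_step_ge0.
Qed.

(** Union bound over the coordinates, using [wait_fail] for each. *)
Lemma chain_fail (L r : nat) (l : seq 'I_n) (z : R) : (0 < L)%N ->
  ex P (fun o : option R => (~~ o)%:R) (chain x L r l z) <=
  (\sum_(i <- l) r%:R / step_prob P x i) / L%:R.
Proof.
move=> L0; elim: l z => [|i l IH] z /=; first by rewrite big_nil mul0r.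
rewrite ex_bind big_cons mulrDl.
apply: (@le_trans _ _ (ex P (fun o : option nat => (~~ o)%:R +
    (\sum_(i <- l) r%:R / step_prob P x i) / L%:R)
    (wait (prefix x i) (fun y => y i == x i) L r 0))).
  apply: ler_ex => -[c|] /=; first by rewrite add0r IH.
  by rewrite lerDl divr_ge0 ?sum_inv_step_ge0.
rewrite exD ex_const lerD2r ler_pdivlMr ?ltr0n //.
have := wait_fail (step_prob_gt0 i Px) L r 0.
by rewrite add0n add0r.
Qed.

(* The factor [1 + 1/r] per coordinate bounds the relative second moment of the
   unbiased estimate [c / r] of [1 / step_prob P x i]. *)
Lemma chain_second_moment (L r : nat) (l : seq 'I_n) (k z : R) : (0 < r)%N ->
  let w := k * z / \prod_(i <- l) step_prob P x i in
  ex P (fun o => if o is Some v then (k * v - 1) ^+ 2 else 0)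
    (chain x L r l z) <=
  (w - 1) ^+ 2 + ((1 + r%:R^-1) ^+ size l - 1) * w ^+ 2.
Proof.
move=> r0; have r0' : 0 < r%:R :> R by rewrite ltr0n.
elim: l z => [|i l IH] z; cbv zeta.
  by rewrite big_nil expr0 subrr mul0r addr0 divr1.
rewrite /= ex_bind big_cons (exprS _ (size l)).
set t := wait _ _ _ _ _; set p := step_prob P x i.
set pi := \prod_(j <- l) _; set A := _ ^+ size l.
have p0 : 0 < p := step_prob_gt0 i Px.
have pi0 : 0 < pi by apply: prodr_gt0 => j _; exact: step_prob_gt0.
have A1 : 1 <= A by rewrite exprn_ege1 // lerDl invr_ge0 ler0n.
have A0 : 0 <= A := le_trans ler01 A1.
(* After [c] samples at coordinate [i], the value of [w] for the rest of the chain is [s * c], so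
   the induction hypothesis is the quadratic [q] at [c]. *)
pose s := k * z / (r%:R * pi).
pose q v := (s * v - 1) ^+ 2 + (A - 1) * (s * v) ^+ 2.
apply: (@le_trans _ _ (ex P (fun o => if o is Some c then q c%:R else 0) t)).
  apply: ler_ex => -[c|] //=; apply: le_trans (IH _) _.
  rewrite -/pi -/A /q le_eqVlt; apply/orP; left; apply/eqP.
  by rewrite /s; field; rewrite !gt_eqF.
apply: (le_trans (@wait_quadratic _ _ _ _ _ p0 q (A * s ^+ 2) (- 2 * s) 1
  L r 0 _ _ _)).
- by rewrite mulr_ge0 ?sqr_ge0.
- by move=> v; rewrite /q; ring.
- by move=> v; rewrite /q addr_ge0 ?sqr_ge0 // mulr_ge0 ?sqr_ge0 ?subr_ge0.
rewrite -/(step_prob P x i) -/p -subr_ge0.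
(* The slack comes from bounding [1 - p] by 1 in the variance. *)
rewrite (_ : _ - _ = A * p * (s ^+ 2 * r%:R / p ^+ 2)); last first.
  by rewrite /q /s; field; rewrite !gt_eqF.
apply: mulr_ge0; first by rewrite mulr_ge0 // ltW.
by rewrite divr_ge0 ?sqr_ge0 // mulr_ge0 ?sqr_ge0 ?ler0n.
Qed.

End Chain.

(** * One estimate of the distance *)

(** The maximum is attained at the set where [P] exceeds [Q]. *)
Lemma dTV_sum (R : realType) (n : nat) (P Q : dist R n) :
  dTV P Q = \sum_x Num.max 0 (P x - Q x).
Proof.
apply/eqP; rewrite eq_le; apply/andP; split.
  apply/bigmax_leP; split=> [|A _].
    by apply: sumr_ge0 => x _; rewrite le_max lexx.
  rewrite /mass -sumrB big_mkcond /=; apply: ler_sum => x _.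
  by case: ifP => _; rewrite le_max lexx ?orbT.
pose A := [set x | 0 < P x - Q x]%SET.
apply: le_trans (le_bigmax _ _ A).
rewrite /mass -sumrB [leRHS]big_mkcond /=; apply: ler_sum => x _.
by rewrite inE; case: ltP.
Qed.

(** With [v] estimating [1 / P x], this estimates [max(0, 1 - Q x / P x)]. Clipping to [0, 1] keeps
    the variance bounded. *)
Definition score (R : realType) (n : nat) (Q : dist R n) (x : cube n)
    (o : option R) : R :=
  if o is Some v then Num.min 1 (Num.max 0 (1 - Q x * v)) else 0.

Lemma whole_neq0 (n : nat) (i : 'I_n) : [set: bool]%SET != finset.set0.
Proof. by apply/set0Pn; exists true; rewrite inE. Qed.

Definition whole (n : nat) : subcube n := Subcube (@whole_neq0 n).

Lemma cond_whole (R : realType) (n : nat) (P : dist R n) : cond P (whole n) =1 P.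
Proof.
have pT : points (whole n) = [set: cube n]%SET.
  by apply/setP => y; rewrite !inE; apply/forallP => i; rewrite inE.
have mT : mass P (points (whole n)) = 1.
  by rewrite pT /mass -(pmf_sum1 P); apply: eq_bigl => y; rewrite inE.
by move=> x; rewrite /cond mT pT inE oner_eq0 divr1.
Qed.

Definition estimate (R : realType) (n : nat) (Q : dist R n) (L r : nat) :
    tree n R :=
  Ask (whole n) (fun x =>
    bind (chain x L r (enum 'I_n) 1) (fun o => Ret (score Q x o))).

Section Estimate.
Context (R : realType) (n : nat) (P Q : dist R n).

Lemma score_itv (x : cube n) (o : option R) : 0 <= score Q x o <= 1.
Proof.
case: o => [v|] /=; last by rewrite lexx ler01.
by rewrite le_min ler01 le_max lexx ge_min lexx.
Qed.

(** Clipping to [[0, c]] is 1-Lipschitz, and [max(0, b)] is the clip of [b]. *)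
Lemma ler_norm_clip (a b c : R) : 0 <= c -> b <= c ->
  `|Num.min c (Num.max 0 a) - Num.max 0 b| <= `|a - b|.
Proof.
move=> c0 bc; have /andP[ab ba] : - `|a - b| <= a - b <= `|a - b|.
  by rewrite -ler_norml.
have ab0 := normr_ge0 (a - b); set d := `|a - b| in ab ba ab0 *.
rewrite ler_norml; apply/andP; split;
  by case: (ltP 0 a) => ha; case: (ltP 0 b) => hb; case: (ltP c _) => hc; lra.
Qed.

(** Stands in for Cauchy-Schwarz: being linear in [y ^+ 2], the bound passes directly through
    [ex]. *)
Lemma ler_norm_amgm (e y : R) : 0 < e -> `|y| <= (e + y ^+ 2 / e) / 2.
Proof.
move=> e0; rewrite -subr_ge0 -(real_normK (num_real y)).
rewrite (_ : _ - _ = (`|y| - e) ^+ 2 / (2 * e)); last first.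
  by field; rewrite gt_eqF.
by rewrite divr_ge0 ?sqr_ge0 // mulr_ge0 // ltW.
Qed.

(** A failed chain costs at most [P x]; otherwise the error is at most [Q x * |P x * v - 1|]. *)
Lemma score_error (x : cube n) (o : option R) (e : R) : 0 < e -> 0 < P x ->
  `|P x * score Q x o - Num.max 0 (P x - Q x)| <=
  P x * (~~ o)%:R + Q x / 2 *
    (e + e^-1 * (if o is Some v then (P x * v - 1) ^+ 2 else 0)).
Proof.
move=> e0 Px; have Q0 := Defs.pmf_ge0 Q x.
case: o => [v|] /=.
  rewrite mulr0 add0r minr_pMr ?(ltW Px) // maxr_pMr ?(ltW Px) // mulr1 mulr0.
  apply: le_trans (ler_norm_clip _ (ltW Px) _) _; first by rewrite gerBl.
  have -> : P x * (1 - Q x * v) - (P x - Q x) = - (Q x * (P x * v - 1)) by ring.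
  rewrite normrN normrM (ger0_norm Q0) -mulrA ler_wpM2l //.
  by rewrite [leRHS]mulrC [e^-1 * _]mulrC ler_norm_amgm.
rewrite !mulr0 addr0 mulr1 sub0r normrN ger0_norm ?le_max ?lexx //.
have Qe0 : 0 <= Q x / 2 * e by rewrite !mulr_ge0 ?invr_ge0 ?(ltW e0).
by rewrite ge_max addr_ge0 ?(ltW Px) //= lerD // (le_trans _ Qe0) // oppr_le0.
Qed.

Lemma sum_chain_steps (r : nat) :
  \sum_x P x * (\sum_(i <- enum 'I_n) r%:R / step_prob P x i) <=
  2 * n%:R * r%:R.
Proof.
under eq_bigr do rewrite big_enum mulr_sumr /=.
rewrite exchange_big /=.
apply: (@le_trans _ _ (\sum_(i < n) 2 * r%:R)).
  apply: ler_sum => i _; under eq_bigr do rewrite mulrCA.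
  by rewrite -mulr_sumr mulrC ler_wpM2r ?ler0n ?sum_inv_step_prob.
by rewrite sumr_const card_ord -(mulr_natr (2 * _)) mulrAC.
Qed.

Lemma cost_estimate (L r : nat) :
  cost P (estimate Q L r) <= 1 + 2 * n%:R * r%:R.
Proof.
rewrite /estimate /=.
apply: (@le_trans _ _ (\sum_x (P x +
    P x * (\sum_(i <- enum 'I_n) r%:R / step_prob P x i)))).
  apply: ler_sum => x _; rewrite cond_whole cost_bind /= ex_const addr0.
  rewrite mulrDr mulr1 lerD2l.
  (* Points of probability zero are never drawn; the chain bounds need [0 < P x]. *)
  have := Defs.pmf_ge0 P x; rewrite le_eqVlt => /orP[/eqP <-|Px].
    by rewrite !mul0r.
  by rewrite ler_wpM2l ?(ltW Px) // cost_chain.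
by rewrite big_split /= pmf_sum1 lerD2l sum_chain_steps.
Qed.

(** Cut-off waits contribute at most [e] by the choice of [L], and the spread of the inverse
    estimates at most [e] by the choice of [r], as [Q] sums to 1. *)
Lemma estimate_bias (L r : nat) (e : R) : (0 < L)%N -> (0 < r)%N -> 0 < e ->
  (1 + r%:R^-1) ^+ n - 1 <= e ^+ 2 -> 2 * n%:R * r%:R <= e * L%:R ->
  `|ex P id (estimate Q L r) - dTV P Q| <= 2 * e.
Proof.
move=> L0 r0 e0 re Le; rewrite /estimate /= dTV_sum -sumrB.
apply: le_trans (ler_norm_sum _ _ _) _.
apply: (@le_trans _ _ (\sum_x ((P x *
    (\sum_(i <- enum 'I_n) r%:R / step_prob P x i)) / L%:R + Q x * e))).
  apply: ler_sum => x _; rewrite cond_whole ex_bind /=.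
  have Q0 := Defs.pmf_ge0 Q x.
  have := Defs.pmf_ge0 P x; rewrite le_eqVlt => /orP[/eqP <-|Px].
    rewrite !mul0r !sub0r add0r (max_l _) ?oppr_le0 // oppr0 normr0.
    by rewrite mulr_ge0 // ltW.
  set t := chain _ _ _ _ _.
  have -> : P x * ex P (score Q x) t - Num.max 0 (P x - Q x) =
      ex P (fun o => P x * score Q x o - Num.max 0 (P x - Q x)) t.
    by rewrite exD exZ ex_const.
  apply: (@le_trans _ _ (ex P (fun o : option R => P x * (~~ o)%:R + Q x / 2 *
    (e + e^-1 * (if o is Some v then (P x * v - 1) ^+ 2 else 0))) t)).
    by apply: ler_norm_ex => o; exact: score_error.
  rewrite exD !exZ exD exZ ex_const.
  rewrite lerD //.
    by rewrite -mulrA ler_wpM2l ?(ltW Px) // chain_fail.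
  rewrite -mulrA ler_wpM2l // ler_pdivrMl ?ltr0n // mulr_natl mulr2n lerD2l.
  rewrite ler_pdivrMl // -expr2.
  (* By the chain rule [w = 1] here, so only [(1 + 1/r)^n - 1] remains. *)
  apply: le_trans (chain_second_moment Px L (enum 'I_n) (P x) 1 r0) _.
  by rewrite prod_step_prob // mulr1 divff ?gt_eqF // subrr expr0n add0r
             expr1n mulr1 size_enum_ord.
rewrite big_split /= -!mulr_suml pmf_sum1 mul1r mulr_natl mulr2n lerD2r.
by rewrite ler_pdivrMr ?ltr0n // (le_trans (sum_chain_steps r)).
Qed.

End Estimate.

(** * Averaging *)

Fixpoint sum_of (R : realType) (n : nat) (t : tree n R) (m : nat) (s : R) :
    tree n R :=
  if m is m'.+1 then bind t (fun w => sum_of t m' (s + w)) else Ret s.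

Definition mean_of (R : realType) (n : nat) (t : tree n R) (m : nat) : tree n R :=
  bind (sum_of t m 0) (fun s => Ret (s / m%:R)).

Section Averaging.
Context (R : realType) (n : nat) (P : dist R n) (t : tree n R).
Let b := ex P id t.

Lemma cost_sum_of (m : nat) (s : R) : cost P (sum_of t m s) = m%:R * cost P t.
Proof.
elim: m s => [|m IH] s /=; first by rewrite mul0r.
rewrite cost_bind (eq_ex P _ (g := fun=> m%:R * cost P t)); last by move=> w.
by rewrite ex_const -natr1 mulrDl mul1r addrC.
Qed.

Lemma cost_mean_of (m : nat) : cost P (mean_of t m) = m%:R * cost P t.
Proof. by rewrite cost_bind cost_sum_of /= ex_const addr0. Qed.

(** The cross term vanishes because [w - b] has mean zero. *)
Lemma ex_sqr_shift (u : R) :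
  ex P (fun w => (u + w) ^+ 2) t = (u + b) ^+ 2 + ex P (fun w => (w - b) ^+ 2) t.
Proof.
have -> : ex P (fun w => (u + w) ^+ 2) t = ex P (fun w => (w - b) ^+ 2 +
    (2 * (u + b) * w + ((u + b) ^+ 2 - 2 * (u + b) * b))) t.
  by apply: eq_ex => w; ring.
by rewrite 2!exD exZ ex_const -/b; ring.
Qed.

Lemma variance_sum_of (m : nat) (s : R) :
  ex P (fun v => (v - m%:R * b) ^+ 2) (sum_of t m s) =
  s ^+ 2 + m%:R * ex P (fun w => (w - b) ^+ 2) t.
Proof.
(* The centre is freed from [m] so that it stays fixed during the induction on [m]. *)
suff gen k : ex P (fun v => (v - k) ^+ 2) (sum_of t m s) =
    (s + m%:R * b - k) ^+ 2 + m%:R * ex P (fun w => (w - b) ^+ 2) t.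
  by rewrite gen addrK.
elim: m s => [|m IH] s /=; first by rewrite !mul0r !addr0.
rewrite ex_bind.
rewrite (eq_ex P _ (g := fun w => (s + m%:R * b - k + w) ^+ 2 +
   m%:R * ex P (fun w => (w - b) ^+ 2) t)); last first.
  by move=> w; rewrite IH; congr (_ + _); ring.
by rewrite exD ex_const ex_sqr_shift -natr1; ring.
Qed.

Lemma mean_of_deviation (m : nat) (e : R) : (0 < m)%N -> 0 < e ->
  ex P (fun w => (w - b) ^+ 2) t <= 1 ->
  1 - (m%:R * e ^+ 2)^-1 <=
  ex P (fun v : R => (`|v - b| <= e)%R%:R) (mean_of t m).
Proof.
move=> m0 e0 var1; have m0' : 0 < m%:R :> R by rewrite ltr0n.
rewrite ex_bind /=.
(* Chebyshev: the indicator of a small deviation is at least 1 minus the squared normalized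
   deviation. *)
apply: (@le_trans _ _ (ex P (fun v => 1 +
    - ((m%:R * e) ^+ 2)^-1 * (v - m%:R * b) ^+ 2) (sum_of t m 0))).
  rewrite exD exZ ex_const variance_sum_of expr0n add0r mulNr lerD2l lerN2.
  have -> : (m%:R * e ^+ 2)^-1 = ((m%:R * e) ^+ 2)^-1 * m%:R.
    by field; rewrite !gt_eqF.
  by rewrite ler_wpM2l ?invr_ge0 ?sqr_ge0 // ler_piMr ?ler0n.
apply: ler_ex => v; rewrite mulNr.
case: (leP `|v / m%:R - b| e) => h.
  by rewrite gerBl mulr_ge0 ?invr_ge0 ?sqr_ge0.
rewrite subr_le0 ler_pdivlMl ?exprn_gt0 ?mulr_gt0 // mulr1.
have -> : v - m%:R * b = m%:R * (v / m%:R - b) by field; rewrite gt_eqF.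
rewrite !exprMn ler_pM2l ?exprn_gt0 // -(real_normK (num_real (v / _ - _))).
by rewrite ler_sqr ?nnegrE ?(ltW e0) // ltW.
Qed.

End Averaging.

(** The variance is at most the second moment, and scores lie in [0, 1]. *)
Lemma estimate_variance (R : realType) (n : nat) (P Q : dist R n) (L r : nat) :
  ex P (fun w => (w - ex P id (estimate Q L r)) ^+ 2) (estimate Q L r) <= 1.
Proof.
set t := estimate Q L r; have := ex_sqr_shift P t 0; rewrite add0r => varE.
apply: (@le_trans _ _ (ex P (fun w => (0 + w) ^+ 2) t)).
  by rewrite varE lerDr sqr_ge0.
rewrite -(cond_sum1 P (whole n)) /t /=; apply: ler_sum => x _.
rewrite ler_piMr ?cond_ge0 // ex_bind /=.
rewrite -[leRHS](ex_const P 1 (chain x L r (enum 'I_n) (1 : R))).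
apply: ler_ex => o; rewrite add0r.
by have /andP[s0 s1] := score_itv Q x o; rewrite exprn_ile1.
Qed.

(** * Choice of the parameters and conclusion *)

Lemma exprn_add1_inv (R : realType) (n N : nat) : (0 < n)%N -> (0 < N)%N ->
  (1 + (n * N.+1)%:R^-1) ^+ n - 1 <= N%:R^-1 :> R.
Proof.
move=> n0 N0; set a : R := (n * N.+1)%:R^-1.
have a0 : 0 <= a by rewrite invr_ge0.
(* At [k = n] the second factor is [1 - 1/(N+1)], the inverse of [1 + 1/N]. *)
have bern (k : nat) : (1 + a) ^+ k * (1 - k%:R * a) <= 1.
  elim: k => [|k IH]; first by rewrite mul0r subr0 mul1r.
  apply: le_trans IH; rewrite exprSr -mulrA ler_wpM2l ?exprn_ge0 ?addr_ge0 //.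
  have k0 : 0 <= k%:R :> R by []; rewrite -natr1; nra.
have na : n%:R * a = N.+1%:R^-1.
  by rewrite /a natrM invfM mulrA mulfV ?mul1r // pnatr_eq0 -lt0n.
have := bern n; rewrite na lerBlDr.
have N0' : 0 < N%:R :> R by rewrite ltr0n.
have -> : 1 - N.+1%:R^-1 = (N%:R^-1 + 1)^-1 :> R.
  by rewrite -natr1; field; rewrite !gt_eqF ?addr_gt0.
by rewrite ler_pdivrMr ?mul1r // addr_gt0 ?invr_gt0.
Qed.

Theorem theorem2 (R : realType) :
  exists (A : forall n : nat, dist R n -> R -> R -> algo R n) (k : nat),
  forall zeta delta : R, 0 < zeta < 1 -> 0 < delta < 1 ->
  exists C : R,
  forall (n : nat) (P Q : dist R n), (0 < n)%N ->
  [/\ (expected_samples P (A n Q zeta delta)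
        <= (C * (n%:R ^+ 2 * (1 + ln n%:R) ^+ k))%:E)%E,
      prob_output P (A n Q zeta delta) predT = 1%E
    & ((1 - delta)%:E <=
        prob_output P (A n Q zeta delta)
          (fun r => `|r - dTV P Q| <= zeta)%R)%E].
Proof.
(* The bias lemma is used with [e = zeta / 4], leaving [zeta / 2] for the deviation of the mean of
   [m] copies. [L] does not enter the cost bound, so it may be large. *)
pose N (zeta : R) := Num.bound ((zeta / 4) ^- 2).
pose r n zeta := (n * (N zeta).+1)%N.
pose L n (zeta : R) := Num.bound (2 * n%:R * (r n zeta)%:R / (zeta / 4)).
pose m (zeta delta : R) := Num.bound (delta * (zeta / 2) ^+ 2)^-1.
(* The exponent 0 is enough: the bound is quadratic without logarithms. *)
exists (fun n Q zeta delta =>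
  algo_of (mean_of (estimate Q (L n zeta) (r n zeta)) (m zeta delta))), 0.
move=> zeta delta /andP[z0 _] /andP[d0 _].
(* The summand 1 pays for the initial sample of each copy, absorbed through [1 <= n ^ 2]. *)
exists ((m zeta delta)%:R * (1 + 2 * (N zeta).+1%:R)) => n P Q n0.
have e0 : 0 < zeta / 4 by rewrite divr_gt0.
have NP : (zeta / 4) ^- 2 < (N zeta)%:R.
  by rewrite archi_boundP // invr_ge0 exprn_ge0 // ltW.
have N0 : (0 < N zeta)%N.
  by rewrite -(ltr0n R) (lt_trans _ NP) // invr_gt0 exprn_gt0.
have r0 : (0 < r n zeta)%N by rewrite muln_gt0 n0.
have LP : 2 * n%:R * (r n zeta)%:R / (zeta / 4) < (L n zeta)%:R.
  by rewrite archi_boundP // divr_ge0 ?mulr_ge0 // ltW.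
have L0 : (0 < L n zeta)%N.
  by rewrite -(ltr0n R) (lt_trans _ LP) // divr_gt0 ?mulr_gt0 ?ltr0n.
have dz0 : 0 < delta * (zeta / 2) ^+ 2 by rewrite mulr_gt0 ?exprn_gt0 ?divr_gt0.
have mP : (delta * (zeta / 2) ^+ 2)^-1 < (m zeta delta)%:R.
  by rewrite archi_boundP // invr_ge0 ltW.
have m0 : (0 < m zeta delta)%N by rewrite -(ltr0n R) (lt_trans _ mP) // invr_gt0.
split; [|exact: prob_output_total|].
  apply: expected_samples_le; rewrite cost_mean_of expr0 mulr1 -mulrA.
  rewrite ler_wpM2l //; apply: le_trans (cost_estimate _ _ _ _) _.
  have n1 : 1 <= n%:R ^+ 2 :> R by rewrite exprn_ege1 // ler1n.
  by rewrite /r natrM; lra.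
apply: le_trans (prob_output_ge _ _ _); rewrite lee_fin.
set t := estimate _ _ _.
apply: (@le_trans _ _ (1 - ((m zeta delta)%:R * (zeta / 2) ^+ 2)^-1)).
  rewrite lerD2l lerN2 -[leRHS]invrK lef_pV2 ?posrE ?invr_gt0 //; last first.
    by rewrite mulr_gt0 ?ltr0n ?exprn_gt0 ?divr_gt0.
  rewrite -ler_pdivrMr ?exprn_gt0 ?divr_gt0 // -invfM.
  exact: ltW.
have z2 : 0 < zeta / 2 by rewrite divr_gt0.
apply: (le_trans (mean_of_deviation m0 z2 (estimate_variance P Q _ _))).
apply: ler_ex => v; rewrite ler_nat.
have bias : `|ex P id t - dTV P Q| <= zeta / 2.
  have -> : zeta / 2 = 2 * (zeta / 4) by field.
  apply: estimate_bias => //.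
    apply: le_trans (exprn_add1_inv _ n0 N0) _.
    by rewrite -[leRHS]invrK lef_pV2 ?posrE ?invr_gt0 ?exprn_gt0 ?ltr0n // ltW.
  by rewrite [leRHS]mulrC -ler_pdivrMr // ltW.
case: (leP `|v - ex P id t| (zeta / 2)) => //= dev.
rewrite lt0b (le_trans (ler_distD (ex P id t) _ _)) //.
by rewrite (splitr zeta) lerD.
Qed.
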